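(* Let $t\ge 1$ and $s\ge 2$ be integers. Then $\chi_p(P_{3t}\Diamond_3 C_{4s+1})\le 4$ if $1\le t\le 2$, and $\chi_p(P_{3t}\Diamond_3 C_{4s+1})\le 5$ if $t\ge 3$. Moreover, equality holds for $t\in\{1,2\}$.
   Context: A packing $k$-coloring of a graph $H$ is a map $c:V(H)\to\{1,\ldots,k\}$ such that any two distinct vertices $u,v$ with $c(u)=c(v)=i$ satisfy $d_H(u,v)\ge i+1$. The packing chromatic number $\chi_p(H)$ is the least such $k$. $P_m$ denotes the path $v_1\cdots v_m$ and $C_n$ the cycle on $n$ vertices. Path-aligned product: for positive integers $\ell\mid m$ and a connected vertex-transitive graph $G$ containing $P_\ell$ as a subgraph, $P_m\Diamond_\ell G$ is formed from the path $P_m=v_1\cdots v_m$ and $m/\ell$ pairwise disjoint copies of $G$, where for each $1\le i\le m/\ell$ the consecutive path vertices $v_{(i-1)\ell+1},\ldots,v_{i\ell}$ are identified, in order, with the vertices of a path $P_\ell$ (i.e. $\ell$ consecutive cycle vertices when $G$ is a cycle) in the $i$-th copy of $G$. *)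

(* Defs.v *)
(* Graphs are symmetric irreflexive relations on finite types. *)
From mathcomp Require Import all_boot.

Set Implicit Arguments.
Unset Strict Implicit.
Unset Printing Implicit Defensive.

Section Graphs.
Variables (T : finType) (e : rel T).

Definition walk (n : nat) (u v : T) : bool :=
  [exists p : n.-tuple T, path e u p && (last u p == v)].

Lemma connect_walk (u v : T) : connect e u v -> exists n, walk n u v.
Proof.
case/connectP=> p ep ->; exists (size p).
by apply/existsP; exists (in_tuple p); rewrite ep eqxx.
Qed.

(* [None] is the infinite distance between different components. *)
Definition gdist (u v : T) : option nat :=
  match @idP (connect e u v) with
  | ReflectT uv => Some (ex_minn (connect_walk uv))
  | ReflectF _ => None
  end.

Definition gdist_ge (u v : T) (n : nat) : bool :=
  if gdist u v is Some d then n <= d else true.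

(* The colour set {1, ..., k} is the nonzero part of 'I_k.+1. *)
Definition packing_coloring (k : nat) (c : {ffun T -> 'I_k.+1}) : bool :=
  [forall v, 0 < c v] &&
  [forall u, forall v, (u != v) && (c u == c v) ==> gdist_ge u v (c u).+1].

Definition packing_colorable (k : nat) : bool :=
  [exists c : {ffun T -> 'I_k.+1}, packing_coloring c].

Lemma packing_colorable_exists : exists k, packing_colorable k.
Proof.
exists #|T|; apply/existsP; exists [ffun v => lift ord0 (enum_rank v)].
apply/andP; split; first by apply/forallP=> v; rewrite ffunE.
apply/forallP=> u; apply/forallP=> v; apply/implyP=> /andP[uv].
by rewrite !ffunE (inj_eq lift_inj) (inj_eq enum_rank_inj) (negPf uv).
Qed.

Definition packing_chromatic_number : nat := ex_minn packing_colorable_exists.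

End Graphs.

Definition path_graph (m : nat) : rel 'I_m :=
  fun i j => (i.+1 == j :> nat) || (j.+1 == i :> nat).

(* The cycle on n vertices, for n >= 3. *)
Definition cycle_graph (n : nat) : rel 'I_n :=
  fun i j => (i.+1 %% n == j) || (j.+1 %% n == i).

Definition subgraph_embedding (S T : finType) (eS : rel S) (eT : rel T)
    (f : S -> T) : Prop :=
  injective f /\ {homo f : x y / eS x y >-> eT x y}.

(* The path-aligned product of P_m and G = (T, e), for l > 0 dividing m.      *)
(* [emb i] is the path P_l chosen in the i-th copy of G; every path vertex is *)
(* identified with a vertex of a copy of G, so the vertices are the pairs     *)
(* (i, x) with x a vertex of the i-th copy. Indices start at 0: the path      *)
(* vertex i * l + j is the vertex (i, emb i j).                               *)
Section PathAligned.
Variables (m l : nat) (T : finType) (e : rel T).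
Variable emb : 'I_(m %/ l) -> 'I_l -> T.

Definition path_vertex (k : 'I_m) (x : 'I_(m %/ l) * T) : bool :=
  [exists j : 'I_l, (k == x.1 * l + j :> nat) && (x.2 == emb x.1 j)].

Definition path_aligned : rel ('I_(m %/ l) * T)%type :=
  fun x y => (x.1 == y.1) && e x.2 y.2 ||
    [exists k, exists k',
      [&& path_graph k k', path_vertex k x & path_vertex k' y]].

Lemma path_aligned_sym : symmetric e -> symmetric path_aligned.
Proof.
move=> es.
suff imp x y : path_aligned x y -> path_aligned y x by move=> x y; apply/idP/idP; exact: imp.
case/orP=> [/andP[/eqP xy exy]|/existsP[k /existsP[k' /and3P[kk kx ky]]]]; apply/orP.
  by left; rewrite xy eqxx es.
right; apply/existsP; exists k'; apply/existsP; exists k.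
by rewrite kx ky !andbT /path_graph orbC.
Qed.

Lemma path_aligned_irr :
  irreflexive e -> (forall i, injective (emb i)) -> irreflexive path_aligned.
Proof.
move=> ei embI x; apply/negP=> /orP[|]; first by rewrite ei andbF.
case/existsP=> k /existsP[k' /and3P[kk /existsP[j /andP[/eqP kj /eqP xj]]]].
case/existsP=> j' /andP[/eqP kj' /eqP]; rewrite xj => /embI jj.
by move: kk; rewrite /path_graph kj kj' jj -[_.+1]addn1 orbb -[X in _ == X]addn0 eqn_add2l.
Qed.

End PathAligned.

(* Main.v *)
(** Read each copy of [C_(4s+1)] from the attached path, so that the path
    occupies positions 0, 1, 2.  Colour copy [i] by a word whose last four
    letters repeat around the cycle: [24131213] and [21341213] for two copies,
    [12413121] and [12513121] alternately for longer paths.  Colours are at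
    most 5, so only vertices at distance at most 5 matter, and all such pairs
    already occur in words of bounded length.

    Conversely, a packing colouring of a cycle with colours 1, 2, 3 has
    period 4; on [C_(4s+1)] it then has period 1, which is absurd. *)
Require Import Defs.
From mathcomp Require Import all_boot zify.

Set Implicit Arguments.
Unset Strict Implicit.
Unset Printing Implicit Defensive.

Section Distance.
Variables (T : finType) (e : rel T).

Lemma walk0 u : walk e 0 u u.
Proof. by apply/existsP; exists [tuple]; rewrite /= eqxx. Qed.

Lemma walk_step m u v w : e u v -> walk e m v w -> walk e m.+1 u w.
Proof.
move=> uv /existsP[p /andP[vp pw]].
by apply/existsP; exists (cons_tuple v p); rewrite /= uv vp.
Qed.

Lemma gdist_geP u v n :
  reflect (forall m, walk e m u v -> n <= m) (gdist_ge e u v n).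
Proof.
rewrite /gdist_ge /gdist; destruct (@idP (connect e u v)) as [uv|nuv].
  case: ex_minnP => d duv dmin; apply: (iffP idP) => [nd m /dmin|]; last exact.
  exact: leq_trans.
apply: (iffP idP) => // _ m /existsP[p /andP[up /eqP pv]].
by case: nuv; apply/connectP; exists p.
Qed.

Lemma gdist_ge_lipschitz (f : T -> nat) u v n :
    f u = 0 -> (forall x y, e x y -> f y <= (f x).+1) -> n <= f v ->
  gdist_ge e u v n.
Proof.
move=> fu0 flip nv; apply/gdist_geP => m /existsP[p /andP[up /eqP pv]].
apply: leq_trans nv _; rewrite -pv.
suff H x (s : seq T) : path e x s -> f (last x s) <= f x + size s.
  by have := H u _ up; rewrite fu0 size_tuple.
elim: s x => [|y s IHs] x /=; first by rewrite addn0.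
by case/andP=> /flip xy /IHs; lia.
Qed.

Lemma packing_chromatic_number_le k :
  packing_colorable e k -> packing_chromatic_number e <= k.
Proof. by rewrite /packing_chromatic_number; case: ex_minnP => m _; apply. Qed.

Lemma packing_colorableP k :
  reflect (exists2 c : T -> nat, forall v, 0 < c v <= k &
             forall u v, u != v -> c u = c v -> gdist_ge e u v (c u).+1)
          (packing_colorable e k).
Proof.
apply: (iffP existsP) => [[c /andP[/forallP c0 /forallP cP]]|[c ck cP]].
  exists (fun v => nat_of_ord (c v)) => [v|u v uv cuv]; first by rewrite c0 -ltnS ltn_ord.
  by move/forallP/(_ v)/implyP: (cP u); apply; rewrite uv; apply/eqP/val_inj.
have cE v : (inord (c v) : 'I_k.+1) = c v :> nat.
  by rewrite inordK // ltnS; case/andP: (ck v).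
exists [ffun v => inord (c v)]; apply/andP; split.
  by apply/forallP=> v; rewrite ffunE cE; case/andP: (ck v).
apply/forallP=> u; apply/forallP=> v; apply/implyP=> /andP[uv].
by rewrite !ffunE -val_eqE /= !cE => /eqP; apply: cP.
Qed.

End Distance.

Definition cdist (n p q : nat) : nat :=
  minn ((p - q) + (q - p)) (n - ((p - q) + (q - p))).

Lemma cycle_graphE n (i j : 'I_n) : cycle_graph i j =
  [|| i.+1 == j :> nat, j.+1 == i :> nat,
      (i.+1 == n) && (j == 0 :> nat) | (j.+1 == n) && (i == 0 :> nat)].
Proof.
have modS (k l : 'I_n) :
    (k.+1 %% n == l) = (k.+1 == l :> nat) || (k.+1 == n) && (l == 0 :> nat).
  have := ltn_ord k; have := ltn_ord l.
  have [->|kn] := eqVneq k.+1 n; first by rewrite modnn; lia.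
  by move=> ? ?; rewrite modn_small; lia.
by rewrite /cycle_graph !modS; case: eqP; case: eqP; rewrite /= ?orbT //; lia.
Qed.

Lemma cdist_cycle_graph n (p : nat) (i j : 'I_n) :
  p < n -> cycle_graph i j -> cdist n p j <= (cdist n p i).+1.
Proof.
have := ltn_ord i; have := ltn_ord j; rewrite cycle_graphE /cdist; lia.
Qed.

Lemma cycle_rotation n (a : 'I_n) :
  exists2 g : 'I_n -> 'I_n, injective g & {homo g : x y / cycle_graph x y} /\
    forall x, g x = (if a <= x then x - a else x + n - a) :> nat.
Proof.
pose h (x : 'I_n) := if a <= x then x - a else x + n - a.
have an := ltn_ord a.
have hn x : h x < n by have := ltn_ord x; rewrite /h; case: ifP; lia.
exists (fun x => Ordinal (hn x)) => [x y [hxy]|]; last split=> // x y.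
  apply: val_inj; move: hxy; have := ltn_ord x; have := ltn_ord y.
  by rewrite /h /=; case: ifP; case: ifP; lia.
have := ltn_ord x; have := ltn_ord y; rewrite !cycle_graphE /= /h => yn xn.
by case: ifP => ay; case: ifP => ax /or4P[] exy; lia.
Qed.

Lemma cycle_reflection n (a : 'I_n) :
  exists2 g : 'I_n -> 'I_n, injective g & {homo g : x y / cycle_graph x y} /\
    forall x, g x = (if x <= a then a - x else a + n - x) :> nat.
Proof.
pose h (x : 'I_n) := if x <= a then a - x else a + n - x.
have an := ltn_ord a.
have hn x : h x < n by have := ltn_ord x; rewrite /h; case: ifP; lia.
exists (fun x => Ordinal (hn x)) => [x y [hxy]|]; last split=> // x y.
  apply: val_inj; move: hxy; have := ltn_ord x; have := ltn_ord y.
  by rewrite /h /=; case: ifP; case: ifP; lia.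
have := ltn_ord x; have := ltn_ord y; rewrite !cycle_graphE /= /h => yn xn.
by case: ifP => ay; case: ifP => ax /or4P[] exy; lia.
Qed.

Lemma subgraph_embedding_coord n (f : 'I_3 -> 'I_n) : 2 < n ->
    subgraph_embedding (@path_graph 3) (@cycle_graph n) f ->
  exists2 g : 'I_n -> 'I_n, injective g &
    {homo g : x y / cycle_graph x y} /\ forall j, g (f j) = j :> nat.
Proof.
move=> n3 [finj fhom].
pose o0 : 'I_3 := ord0; pose o1 : 'I_3 := inord 1; pose o2 : 'I_3 := inord 2.
have o1E : o1 = 1 :> nat by rewrite inordK.
have o2E : o2 = 2 :> nat by rewrite inordK.
have e01 : cycle_graph (f o0) (f o1) by apply: fhom; rewrite /path_graph o1E.
have e12 : cycle_graph (f o1) (f o2) by apply: fhom; rewrite /path_graph o1E o2E.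
have n02 : (f o0 != f o2 :> nat).
  by rewrite val_eqE (inj_eq finj) -val_eqE /= o2E.
have jE (P : 'I_3 -> Prop) : P o0 -> P o1 -> P o2 -> forall j, P j.
  move=> P0 P1 P2 j.
  have [j0|j1|j2] : [\/ j = 0 :> nat, j = 1 :> nat | j = 2 :> nat].
  - by case: j => -[|[|[|]]] //= ?; [apply: Or31 | apply: Or32 | apply: Or33].
  - by rewrite (_ : j = o0) //; apply: val_inj.
  - by rewrite (_ : j = o1) //; apply: val_inj; rewrite /= o1E.
  - by rewrite (_ : j = o2) //; apply: val_inj; rewrite /= o2E.
have := ltn_ord (f o0); have := ltn_ord (f o1); have := ltn_ord (f o2).
move: e01 e12; rewrite !cycle_graphE => e01 e12 f2 f1 f0.
have [up|down] : ((f o0).+1 == f o1 :> nat) || ((f o0).+1 == n) && (f o1 == 0 :> nat)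
  \/ ((f o1).+1 == f o0 :> nat) || ((f o1).+1 == n) && (f o0 == 0 :> nat) by lia.
- have [g gI [ghom gE]] := cycle_rotation (f o0); exists g => //; split=> //.
  by apply: (jE (fun j => g (f j) = j :> nat)); rewrite gE /= ?o1E ?o2E; case: ifP; lia.
- have [g gI [ghom gE]] := cycle_reflection (f o0); exists g => //; split=> //.
  by apply: (jE (fun j => g (f j) = j :> nat)); rewrite gE /= ?o1E ?o2E; case: ifP; lia.
Qed.

Section ProductDistance.
Variables (m n : nat) (emb : 'I_(m %/ 3) -> 'I_3 -> 'I_n).
Variable coord : 'I_(m %/ 3) -> 'I_n -> 'I_n.
Hypothesis n_gt3 : 3 < n.
Hypothesis coord_homo : forall i, {homo coord i : x y / cycle_graph x y}.
Hypothesis coord_emb : forall i j, coord i (emb i j) = j :> nat.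
Hypothesis emb_homo :
  forall i, {homo emb i : x y / path_graph x y >-> cycle_graph x y}.

Lemma path_aligned_cases (x y : 'I_(m %/ 3) * 'I_n) :
    path_aligned (@cycle_graph n) emb x y ->
  [\/ x.1 = y.1 /\ cycle_graph (coord x.1 x.2) (coord y.1 y.2),
      [/\ y.1 = x.1.+1 :> nat, coord x.1 x.2 = 2 :> nat
        & coord y.1 y.2 = 0 :> nat]
    | [/\ x.1 = y.1.+1 :> nat, coord x.1 x.2 = 0 :> nat
        & coord y.1 y.2 = 2 :> nat]].
Proof.
case: x y => [i a] [i' a'] /orP[/= /andP[/eqP <- aa']|].
  by apply: Or31; split=> //; apply: coord_homo.
case/existsP=> k /existsP[k' /and3P[kk' /existsP[j /= /andP[/eqP kE /eqP ->]]]].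
case/existsP=> j' /= /andP[/eqP k'E /eqP ->]; rewrite !coord_emb.
have := ltn_ord j; have := ltn_ord j'; move: kk'.
rewrite /path_graph kE k'E => kk' j'3 j3.
have [ii'|[ii'|ii']] : i = i' :> nat \/ i' = i.+1 :> nat \/ i = i'.+1 :> nat by lia.
- move/val_inj: ii' => ii'; rewrite -{}ii' in kk' k'E *.
  apply: Or31; split=> //; apply/coord_homo/emb_homo.
  by rewrite /path_graph; lia.
- by apply: Or32; split; lia.
- by apply: Or33; split; lia.
Qed.

Definition pdist (x y : 'I_(m %/ 3) * 'I_n) : nat :=
  if x.1 == y.1 :> nat then cdist n (coord x.1 x.2) (coord y.1 y.2)
  else if x.1 < y.1 then
    cdist n (coord x.1 x.2) 2 + (3 * (y.1 - x.1.+1)).+1 + cdist n (coord y.1 y.2) 0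
  else
    cdist n (coord y.1 y.2) 2 + (3 * (x.1 - y.1.+1)).+1 + cdist n (coord x.1 x.2) 0.

Lemma gdist_ge_pdist x y k :
  k <= pdist x y -> gdist_ge (path_aligned (@cycle_graph n) emb) x y k.
Proof.
apply: (@gdist_ge_lipschitz _ _ (pdist x)) => [|v w /path_aligned_cases].
  by rewrite /pdist eqxx /cdist; lia.
rewrite /pdist; move: (coord x.1 x.2) (coord v.1 v.2) (coord w.1 w.2) => p q r.
have pn := ltn_ord p; have qn := ltn_ord q; have rn := ltn_ord r.
have cdistC a b : cdist n a b = cdist n b a by rewrite /cdist; lia.
case=> [[-> qr]|[-> -> ->]|[-> -> ->]].
- have := cdist_cycle_graph pn qr.
  have := @cdist_cycle_graph _ 0 _ _ (ltn_trans (ltn0Sn _) n_gt3) qr.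
  have := @cdist_cycle_graph _ 2 _ _ (ltnW n_gt3) qr.
  rewrite !(cdistC 0) !(cdistC 2).
  by case: eqP => ?; [|case: ifP => ?]; lia.
- by rewrite /cdist; case: eqP => ?; [|case: ifP => ?];
    (case: eqP => ?; [|case: ifP => ?]); lia.
- by rewrite /cdist; case: eqP => ?; [|case: ifP => ?];
    (case: eqP => ?; [|case: ifP => ?]); lia.
Qed.

End ProductDistance.

Definition letter (w : seq nat) (p : nat) : nat :=
  nth 0 w (if p < 4 then p else 4 + p %% 4).

(* The first test covers pairs joined by an arc avoiding the step from the last
   position to 0, the second those joined across it; the latter look the same in
   every [C_(4s+1)] with [s >= 2], whence the bound 9. *)
Definition copy_ok (w : seq nat) : bool :=
  all (fun p => all (fun d => (letter w p == letter w (p + d)) ==>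
    (letter w p < d)) (iota 1 5)) (iota 0 8) &&
  all (fun p => all (fun q => (p < q) && (letter w p == letter w q) ==>
    (letter w p < cdist 9 p q)) (iota 0 9)) (iota 0 9).

Definition cross_ok (g : nat) (w w' : seq nat) : bool :=
  all (fun p => all (fun q => (letter w p == letter w' q) ==>
    (letter w p < cdist 9 p 2 + g + cdist 9 q 0)) (iota 0 9)) (iota 0 9).

Lemma copy_okP w s p q : 2 <= s -> copy_ok w -> p < q < 4 * s + 1 ->
  letter w p = letter w q -> letter w p <= 5 -> letter w p < cdist (4 * s + 1) p q.
Proof.
move=> s2 /andP[/allP wlin /allP wcyc] pq wpq w5; rewrite ltnNge; apply/negP => le.
have letterE a b : a %% 4 = b %% 4 -> 4 <= a -> 4 <= b -> letter w a = letter w b.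
  by move=> ab a4 b4; rewrite /letter ab ![_ < 4]ltnNge a4 b4.
have [qp|qp] : q - p <= letter w q \/ 4 * s + 1 - (q - p) <= letter w q.
  by move: le; rewrite /cdist; lia.
  pose p' := if p < 8 then p else 4 + p %% 4.
  have p'E : letter w p' = letter w p by rewrite /p'; case: ifP => // ?; apply: letterE; lia.
  have q'E : letter w (p' + (q - p)) = letter w q.
    by rewrite /p'; case: ifP => ?; [congr letter; lia | apply: letterE; lia].
  have p'8 : p' \in iota 0 8 by rewrite mem_iota /p'; case: ifP; lia.
  have /allP/(_ (q - p)) := wlin _ p'8.
  by rewrite mem_iota p'E q'E wpq eqxx /=; lia.
pose q' := q + 8 - 4 * s.
have q'E : letter w q' = letter w q by apply: letterE; rewrite /q'; lia.
have p9 : p \in iota 0 9 by rewrite mem_iota; lia.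
have /allP/(_ q') := wcyc _ p9.
by rewrite mem_iota q'E wpq eqxx /= /cdist /q'; lia.
Qed.

Lemma letter_reduce s p a : 2 <= s -> p < 4 * s + 1 -> a \in [:: 0; 2] ->
    cdist (4 * s + 1) p a <= 4 ->
  exists2 p', p' \in iota 0 9 &
    cdist 9 p' a = cdist (4 * s + 1) p a /\ forall w, letter w p' = letter w p.
Proof.
rewrite !inE => s2 ps a02 pa.
exists (if p <= 6 then p else p + 8 - 4 * s).
  by rewrite mem_iota; case: ifP; move: pa; rewrite /cdist; lia.
split; first by case: ifP; move: pa; rewrite /cdist; lia.
move=> w; case: ifP => // p6; rewrite /letter.
have p4 : 3 < p + 8 - 4 * s by move: pa; rewrite /cdist; lia.
have p4' : 3 < p by lia.
have -> : (p + 8 - 4 * s) %% 4 = p %% 4 by lia.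
by rewrite ![_ < 4]ltnNge p4 p4'.
Qed.

Lemma cross_okP g w w' s p q : 0 < g -> 2 <= s -> cross_ok g w w' ->
    p < 4 * s + 1 -> q < 4 * s + 1 -> letter w p = letter w' q -> letter w p <= 5 ->
  letter w p < cdist (4 * s + 1) p 2 + g + cdist (4 * s + 1) q 0.
Proof.
move=> g0 s2 /allP ok ps qs wpq w5; rewrite ltnNge; apply/negP => le.
have [||p' p'9 [p'2 p'E]] := @letter_reduce s p 2 s2 ps; [by []|lia|].
have [||q' q'9 [q'0 q'E]] := @letter_reduce s q 0 s2 qs; [by []|lia|].
have /allP/(_ q' q'9) := ok _ p'9.
by rewrite p'E q'E wpq eqxx /= p'2 q'0; lia.
Qed.

Lemma packing_colorable_words (t s K : nat)
    (emb : 'I_((3 * t) %/ 3) -> 'I_3 -> 'I_(4 * s + 1)) (w : nat -> seq nat) :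
    2 <= s -> K <= 5 ->
    (forall i, subgraph_embedding (@path_graph 3) (@cycle_graph (4 * s + 1)) (emb i)) ->
    (forall i, size (w i) = 8 /\ all (fun k => 0 < k <= K) (w i)) ->
    (forall i, copy_ok (w i)) ->
    (forall i, i.+1 < t -> cross_ok 1 (w i) (w i.+1)) ->
    (forall i, i.+2 < t -> cross_ok 4 (w i) (w i.+2)) ->
  packing_colorable (@path_aligned (3 * t) 3 _ (@cycle_graph (4 * s + 1)) emb) K.
Proof.
move=> s2 K5 hemb wK wcopy wcross1 wcross2.
have n3 : 2 < 4 * s + 1 by lia.
have /fin_all_exists2[coord coordI /all_and2[coord_homo coord_emb]] :=
  fun i => subgraph_embedding_coord n3 (hemb i).
have emb_homo i := (hemb i).2.
pose c (v : 'I_(3 * t %/ 3) * 'I_(4 * s + 1)) := letter (w v.1) (coord v.1 v.2).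
have cK v : 0 < c v <= K.
  have [w8 /allP] := wK v.1; apply; rewrite /c /letter mem_nth // w8.
  by case: ifP; lia.
apply/packing_colorableP; exists c => // u v uv cuv.
apply: (gdist_ge_pdist _ coord_homo coord_emb emb_homo); first lia.
have c5 : c u <= 5 by have := cK u; lia.
have lt_t (i : 'I_(3 * t %/ 3)) : i < t by have := ltn_ord i; lia.
rewrite /pdist; case: eqP => [uv1|/eqP uv1].
  have {}uv1 : u.1 = v.1 by apply: val_inj.
  have ne : coord u.1 u.2 != coord v.1 v.2.
    apply: contraNneq uv; rewrite -uv1 => /coordI uv2.
    by rewrite [u]surjective_pairing [v]surjective_pairing uv1 uv2.
  move: cuv c5 ne; rewrite /c -uv1 -val_eqE /=.
  move: (coord u.1 u.2) (coord u.1 v.2) => p q wpq w5 ne.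
  have pn := ltn_ord p; have qn := ltn_ord q.
  have [pq|qp|/eqP] := ltngtP p q; last by rewrite (negPf ne).
    by apply: copy_okP => //; rewrite pq.
  rewrite wpq in w5 *; have -> : cdist (4 * s + 1) p q = cdist (4 * s + 1) q p.
    by rewrite /cdist; lia.
  by apply: copy_okP => //; rewrite qp.
have sep (x y : 'I_(3 * t %/ 3) * 'I_(4 * s + 1)) : x.1 < y.1 -> c x = c y ->
    c x <= 5 -> c x < cdist (4 * s + 1) (coord x.1 x.2) 2 + (3 * (y.1 - x.1.+1)).+1
                      + cdist (4 * s + 1) (coord y.1 y.2) 0.
  move=> xy cxy cx5; have yt := lt_t y.1.
  have [yE|[yE|far]] : y.1 = x.1.+1 :> nat \/ y.1 = x.1.+2 :> nat \/ x.1.+2 < y.1 by lia.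
  - rewrite yE subnn muln0; apply: cross_okP (ltn_ord _) (ltn_ord _) cxy cx5 => //.
    by rewrite yE; apply: wcross1; rewrite -yE.
  - rewrite yE subSnn muln1; apply: cross_okP (ltn_ord _) (ltn_ord _) cxy cx5 => //.
    by rewrite yE; apply: wcross2; rewrite -yE.
  - by lia.
case: ifP => lt_uv; first exact: sep.
by rewrite cuv; apply: sep; rewrite -?cuv //; lia.
Qed.

Lemma no_packing_3_coloring_cycle (s : nat) (f : nat -> nat) :
    (forall m, 0 < f m <= 3) -> (forall m, f (m + (4 * s + 1)) = f m) ->
  (forall m d, 0 < d <= 3 -> f m = f (m + d) -> f m < d) -> False.
Proof.
move=> f3 fper fP.
have f_neq1 m : f m <> f m.+1.
  by move=> E; have := f3 m; have := fP m 1 isT; rewrite addn1 => /(_ E); lia.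
have f_neq2 m : f m <> 1 -> f m <> f m.+2.
  by move=> m1 E; have := f3 m; have := fP m 2 isT; rewrite addn2 => /(_ E); lia.
have f_neq3 m : f m = 3 -> f m.+3 <> 3.
  by move=> m3 E; have := fP m 3 isT; rewrite addn3 m3 E => /(_ erefl).
have one m : f m.+2 = 1 \/ f m.+3 = 1.
  have [f2|[f2|f2]] : f m.+2 = 1 \/ f m.+2 = 2 \/ f m.+2 = 3 by have := f3 m.+2; lia.
  - by left.
  - right; move: (f3 m) (f3 m.+1) (f3 m.+3) (f_neq1 m) (f_neq1 m.+1) (f_neq1 m.+2).
    by move: (f_neq2 m) (f_neq2 m.+1) (f_neq3 m); lia.
  - right; move: (f3 m.+3) (f3 m.+4) (f3 m.+4.+1) (f_neq1 m.+2) (f_neq1 m.+3) (f_neq1 m.+4).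
    by move: (f_neq2 m.+2) (f_neq2 m.+3) (f_neq3 m.+2); lia.
have step m : f (m.+2 + 4) = f m.+2.
  move: (one m) (one m.+1) (one m.+2) (one m.+3).
  move: (f_neq1 m.+2) (f_neq1 m.+3) (f_neq1 m.+4) (f_neq1 m.+4.+1).
  move: (f_neq2 m.+2) (f_neq2 m.+3) (f_neq2 m.+4).
  move: (f3 m.+2) (f3 m.+3) (f3 m.+4) (f3 m.+4.+1) (f3 m.+4.+2).
  by rewrite !addnS !addn0; lia.
have iter k : f (2 + 4 * k) = f 2.
  elim: k => [|k IHk] //; rewrite -[RHS]IHk -[in RHS]step.
  by congr f; lia.
have := iter s; have -> : f (2 + 4 * s) = f 1 by rewrite -[RHS]fper; congr f; lia.
by move/(fP 1 1 isT); have := f3 1; lia.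
Qed.

Lemma cycle_walk n (n0 : 0 < n) m d :
  walk (@cycle_graph n) d (Ordinal (ltn_pmod m n0)) (Ordinal (ltn_pmod (m + d) n0)).
Proof.
elim: d m => [|d IHd] m; first by rewrite addn0 walk0.
rewrite -addSnnS; apply: walk_step (IHd _).
by rewrite /cycle_graph /= -addn1 modnDml addn1 eqxx.
Qed.

Lemma path_aligned_walk m l (T : finType) (e : rel T)
    (emb : 'I_(m %/ l) -> 'I_l -> T) i d x y :
  walk e d x y -> walk (path_aligned e emb) d (i, x) (i, y).
Proof.
case/existsP=> p /andP[xp /eqP <-]; apply/existsP.
exists (map_tuple (pair i) p); rewrite /= last_map eqxx andbT.
elim: (tval p) x xp => //= z r IHr x /andP[xz zr].
by rewrite IHr // andbT /path_aligned /= eqxx xz.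
Qed.

Lemma packing_chromatic_number_ge4 m s l
    (emb : 'I_(m %/ l) -> 'I_l -> 'I_(4 * s + 1)) :
    0 < m %/ l -> 0 < s ->
  4 <= packing_chromatic_number (path_aligned (@cycle_graph (4 * s + 1)) emb).
Proof.
move=> ml0 s0; rewrite /packing_chromatic_number; case: ex_minnP => k kcol _.
rewrite leqNgt; apply/negP => k3; case/packing_colorableP: kcol => c ck cP.
have n0 : 0 < 4 * s + 1 by lia.
pose f j := c (Ordinal ml0, Ordinal (ltn_pmod j n0)).
apply: (@no_packing_3_coloring_cycle s f) => [j|j|j d d3].
- by have := ck (Ordinal ml0, Ordinal (ltn_pmod j n0)); rewrite /f; lia.
- by congr (c (_, _)); apply: val_inj; rewrite /= modnDr.
- move/cP => /(_ _)/gdist_geP; apply; last exact/path_aligned_walk/cycle_walk.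
  rewrite xpair_eqE eqxx /= -val_eqE /=; apply/negP.
  rewrite -[X in X %% _ == _]addn0 eqn_modDl mod0n modn_small; lia.
Qed.

Unset Implicit Arguments.

Theorem theorem6 (t s : nat) (ht : 1 <= t) (hs : 2 <= s)
    (emb : 'I_((3 * t) %/ 3) -> 'I_3 -> 'I_(4 * s + 1))
    (hemb : forall i, subgraph_embedding (@path_graph 3)
                        (@cycle_graph (4 * s + 1)) (emb i)) :
  let chi := packing_chromatic_number
               (@path_aligned (3 * t) 3 _ (@cycle_graph (4 * s + 1)) emb) in
  [/\ 1 <= t <= 2 -> chi <= 4,
      3 <= t -> chi <= 5
    & t = 1 \/ t = 2 -> chi = 4].
Proof.
move=> chi.
have le4 : 1 <= t <= 2 -> chi <= 4.
  move=> t2; apply: packing_chromatic_number_le.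
  pose w i := if i == 0 then [:: 2; 4; 1; 3; 1; 2; 1; 3] else [:: 2; 1; 3; 4; 1; 2; 1; 3].
  apply: (@packing_colorable_words _ _ _ _ w) => // [i|i|i|i]; rewrite /w.
  - by case: eqP.
  - by case: eqP.
  - by case: i => //= ?; lia.
  - by lia.
have ge4 : 4 <= chi by apply: packing_chromatic_number_ge4; [rewrite mulKn | lia].
split=> // [_|t12]; last by apply/eqP; rewrite eqn_leq ge4 le4 //; lia.
apply: packing_chromatic_number_le.
pose w i := [:: 1; 2; if odd i then 5 else 4; 1; 3; 1; 2; 1].
by apply: (@packing_colorable_words _ _ _ _ w) => // i; rewrite /w /=; case: odd.
Qed.
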